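(* Let $E=\{\exp_\lambda:\lambda\in(0,1)\cap\mathbb{Q}\}$, where $\exp_\lambda(i)=\lambda^i$. For every $\mathrm{LTL}^{\mathrm{disc}}[E]$ formula $\varphi$ over $AP$ and every threshold $v\in[0,1]\cap\mathbb{Q}$, there exists an alternating weak automaton $\mathcal{A}_{\varphi,v}$ over $2^{AP}$ such that for every computation $\pi$: (1) if $[\![\pi,\varphi]\!]>v$ then $\mathcal{A}_{\varphi,v}$ accepts $\pi$; (2) if $\mathcal{A}_{\varphi,v}$ accepts $\pi$ and $\pi$ is a lasso computation, then $[\![\pi,\varphi]\!]>v$. Furthermore, the number of states of $\mathcal{A}_{\varphi,v}$ is singly exponential in $|\langle\varphi\rangle|$ and in the length of the description of $v$.
   Context: Let $AP$ be a finite set of atomic propositions. A computation is $\pi=\pi_0\pi_1\cdots\in(2^{AP})^\omega$, $\pi^i=\pi_i\pi_{i+1}\cdots$; a lasso computation has the form $u\cdot w^\omega$ with $u,w\in(2^{AP})^*$, $w\neq\epsilon$. For a set $\mathcal{D}$ of strictly decreasing functions $\mathbb{N}\to[0,1]$ tending to $0$, $\mathrm{LTL}^{\mathrm{disc}}[\mathcal{D}]$ formulas are $\varphi ::= \mathtt{True}\mid p\mid\neg\varphi\mid\varphi\vee\varphi\mid\mathsf{X}\varphi\mid\varphi\,\mathsf{U}\,\varphi\mid\varphi\,\mathsf{U}_\eta\,\varphi$ ($p\in AP$, $\eta\in\mathcal{D}$), with values: $[\![\pi,\mathtt{True}]\!]=1$; $[\![\pi,p]\!]=1$ if $p\in\pi_0$,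 else $0$; $[\![\pi,\neg\varphi]\!]=1-[\![\pi,\varphi]\!]$; $[\![\pi,\varphi\vee\psi]\!]=\max\{[\![\pi,\varphi]\!],[\![\pi,\psi]\!]\}$; $[\![\pi,\mathsf{X}\varphi]\!]=[\![\pi^1,\varphi]\!]$; $[\![\pi,\varphi\,\mathsf{U}\,\psi]\!]=\sup_{i\ge0}\min\{[\![\pi^i,\psi]\!],\min_{0\le j<i}[\![\pi^j,\varphi]\!]\}$; $[\![\pi,\varphi\,\mathsf{U}_\eta\,\psi]\!]=\sup_{i\ge0}\min\{\eta(i)[\![\pi^i,\psi]\!],\min_{0\le j<i}\eta(j)[\![\pi^j,\varphi]\!]\}$. For an $\mathrm{LTL}^{\mathrm{disc}}[E]$ formula $\varphi$, $|\langle\varphi\rangle|$ is the number of subformulas of $\varphi$ plus the total length in bits of describing the rationals $\lambda$ such that $\mathsf{U}_{\exp_\lambda}$ occurs in $\varphi$. An alternating B\''uchi automaton is $\langle\Sigma,Q,q_{in},\delta,\alpha\rangle$ with finite $Q$, $\delta:Q\times\Sigma\to\mathcal{B}^+(Q)$ (positive Boolean formulas over $Q$, incl. $\mathtt{True},\mathtt{False}$), $\alpha\subseteq Q$; a run on $w=\sigma_0\sigma_1\cdots$ is a DAG on $Q\times\mathbb{N}$ rooted at $\langle q_{in},0\rangle$ in which the successors of each node $\langle q,l\rangle$ satisfy $\delta(q,\sigma_l)$; it is accepting if all infinite paths visit $\alpha$ infinitely often. It is weak if $Q$ is partitioned into sets each contained in or disjoint from $\alpha$, partially ordered so that transitions never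 lead to a larger set. *)

(* Defs.v *)
From HB Require Import structures.
From mathcomp Require Import all_boot all_order all_algebra.
From mathcomp Require Import boolp classical_sets reals.
Set Implicit Arguments. Unset Strict Implicit. Unset Printing Implicit Defensive.
Import Order.TTheory GRing.Theory Num.Theory.
Local Open Scope ring_scope.

Section Formulas.
Variable AP : finType.

Inductive formula : Type :=
| FTrue : formula
| FAtom : AP -> formula
| FNot  : formula -> formula
| FOr   : formula -> formula -> formula
| FNext : formula -> formula
| FUntil : formula -> formula -> formula
| FUntilD : rat -> formula -> formula -> formula.

Fixpoint feqb (f g : formula) : bool :=
  match f, g with
  | FTrue, FTrue => true
  | FAtom p, FAtom q => p == q
  | FNot f1, FNot g1 => feqb f1 g1
  | FOr f1 f2, FOr g1 g2 => feqb f1 g1 && feqb f2 g2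
  | FNext f1, FNext g1 => feqb f1 g1
  | FUntil f1 f2, FUntil g1 g2 => feqb f1 g1 && feqb f2 g2
  | FUntilD l f1 f2, FUntilD m g1 g2 => [&& l == m, feqb f1 g1 & feqb f2 g2]
  | _, _ => false
  end.

Lemma feqP : Equality.axiom feqb.
Proof.
elim=> [|p|f1 IH1|f1 IH1 f2 IH2|f1 IH1|f1 IH1 f2 IH2|l f1 IH1 f2 IH2]
       [|q|g1|g1 g2|g1|g1 g2|m g1 g2] /=; try by constructor.
- by case: eqP => [->|H]; constructor => //; case.
- by case: IH1 => [->|H]; constructor => //; case.
- by case: IH1 => [->|H]; case: IH2 => [->|H'];
     constructor => //; case.
- by case: IH1 => [->|H]; constructor => //; case.
- by case: IH1 => [->|H]; case: IH2 => [->|H'];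
     constructor => //; case.
- by case: eqP => [->|H0]; case: IH1 => [->|H]; case: IH2 => [->|H'];
     constructor => //; case.
Qed.

HB.instance Definition _ := hasDecEq.Build formula feqP.

Fixpoint wf (f : formula) : bool :=
  match f with
  | FTrue | FAtom _ => true
  | FNot g | FNext g => wf g
  | FOr g h | FUntil g h => wf g && wf h
  | FUntilD l g h => [&& 0 < l, l < 1, wf g & wf h]
  end.

Fixpoint subformulas (f : formula) : seq formula :=
  f :: match f with
       | FTrue | FAtom _ => [::]
       | FNot g | FNext g => subformulas g
       | FOr g h | FUntil g h | FUntilD _ g h => subformulas g ++ subformulas h
       end.

Fixpoint lambdas (f : formula) : seq rat :=
  match f with
  | FTrue | FAtom _ => [::]
  | FNot g | FNext g => lambdas g
  | FOr g h | FUntil g h => lambdas g ++ lambdas h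
  | FUntilD l g h => l :: lambdas g ++ lambdas h
  end.
End Formulas.

Definition natbits (n : nat) : nat := (trunc_log 2 n).+1.
Definition ratbits (q : rat) : nat := natbits `|numq q|%N + natbits `|denq q|%N.

Definition fsize (AP : finType) (f : formula AP) : nat :=
  size (undup (subformulas f)) + \sum_(l <- undup (lambdas f)) ratbits l.

Definition computation (AP : finType) := nat -> {set AP}.
Definition suffix (AP : finType) (pi : computation AP) (i : nat) : computation AP :=
  fun k => pi (i + k)%N.

Local Open Scope classical_set_scope.

Fixpoint sem (R : realType) (AP : finType) (f : formula AP) (pi : computation AP) : R :=
  match f with
  | FTrue => 1
  | FAtom p => if p \in pi 0%N then 1 else 0
  | FNot g => 1 - sem R g pi
  | FOr g h => Num.max (sem R g pi) (sem R h pi)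
  | FNext g => sem R g (suffix pi 1)
  | FUntil g h =>
      sup [set Num.min (sem R h (suffix pi i))
                       (\big[Num.min/1]_(j < i) sem R g (suffix pi j)) | i in [set: nat]]
  | FUntilD l g h =>
      sup [set Num.min ((ratr l) ^+ i * sem R h (suffix pi i))
                       (\big[Num.min/1]_(j < i) ((ratr l) ^+ j * sem R g (suffix pi j)))
          | i in [set: nat]]
  end.

Local Close Scope classical_set_scope.

Definition lasso (AP : finType) (pi : computation AP) : Prop :=
  exists (u w : seq {set AP}), w != [::] /\
    forall i, pi i = if (i < size u)%N then nth (@finset.set0 AP) u i
                     else nth (@finset.set0 AP) w ((i - size u) %% size w).

Inductive pbf (Q : Type) : Type :=
| PTrue | PFalse | PVar of Q | PAnd of pbf Q & pbf Q | POr of pbf Q & pbf Q.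
Arguments PTrue {Q}. Arguments PFalse {Q}.

Fixpoint pbf_sat (Q : finType) (S : {set Q}) (b : pbf Q) : bool :=
  match b with
  | PTrue => true
  | PFalse => false
  | PVar q => q \in S
  | PAnd b1 b2 => pbf_sat S b1 && pbf_sat S b2
  | POr b1 b2 => pbf_sat S b1 || pbf_sat S b2
  end.

Fixpoint pbf_atoms (Q : Type) (b : pbf Q) : seq Q :=
  match b with
  | PTrue | PFalse => [::]
  | PVar q => [:: q]
  | PAnd b1 b2 | POr b1 b2 => pbf_atoms b1 ++ pbf_atoms b2
  end.

Record ABA (Sigma : finType) := {
  states : finType;
  q_in : states;
  delta : states -> Sigma -> pbf states;
  acc : {set states} }.

(* A run DAG on Q x N rooted at (q_in,0): node (q,l) has successor set
   r l q (nodes (q',l+1), q' \in r l q).  Nodes of the DAG are those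
   reachable from the root. *)
Definition reachable (Sigma : finType) (A : ABA Sigma)
    (r : nat -> states A -> {set states A}) (l : nat) (q : states A) : Prop :=
  exists p : nat -> states A, p 0%N = q_in A /\ p l = q /\
    forall k, (k < l)%N -> p k.+1 \in r k (p k).
Arguments reachable {Sigma} A r l q.

Definition is_run (Sigma : finType) (A : ABA Sigma) (w : nat -> Sigma)
    (r : nat -> states A -> {set states A}) : Prop :=
  forall l q, reachable A r l q -> pbf_sat (r l q) (delta q (w l)).
Arguments is_run {Sigma} A w r.

Definition accepting_run (Sigma : finType) (A : ABA Sigma)
    (r : nat -> states A -> {set states A}) : Prop :=
  forall p : nat -> states A, p 0%N = q_in A ->
    (forall k, p k.+1 \in r k (p k)) ->
    forall n, exists m, (n <= m)%N /\ p m \in acc A.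
Arguments accepting_run {Sigma} A r.

Definition accepts (Sigma : finType) (A : ABA Sigma) (w : nat -> Sigma) : Prop :=
  exists r, is_run A w r /\ accepting_run A r.

Definition weak (Sigma : finType) (A : ABA Sigma) : Prop :=
  exists (part : states A -> nat) (le : rel nat),
    reflexive le /\ antisymmetric le /\ transitive le /\
    (forall q q', part q = part q' -> (q \in acc A) = (q' \in acc A)) /\
    (forall q s q', q' \in pbf_atoms (delta q s) -> le (part q') (part q)).

(* Main.v *)
Require Import Defs.
From HB Require Import structures.
From mathcomp Require Import all_boot all_order all_algebra.
From mathcomp Require Import boolp classical_sets reals.
From mathcomp Require Import zify.
Import Order.TTheory GRing.Theory Num.Theory.
Set Implicit Arguments. Unset Strict Implicit. Unset Printing Implicit Defensive.
Local Open Scope ring_scope.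

(** The states are assertions "the value of [f] is above (below) [t]". Reading
    [U] as [U_1], the value of [g U_l h] at [pi] is the maximum of [h] and of
    the minimum of [g] and [l] times the value at [pi^1]; so an assertion about
    it unfolds to one about [h], one about [g], and the assertion on
    [g U_l h] at [pi^1] with threshold [t / l]. One unfolding step is an exact
    equivalence on all computations, so a run can only go wrong at infinity.
    The only infinite paths stay in one until assertion; they are rejecting
    except for "[g U h] is below [t]", where what is proved is that every term
    of the supremum is below [t], which suffices on lassos because there the
    supremum is attained.

    A threshold [t / l ^+ j] is kept only while it is at most 1, so [j] is at
    most the bit size of [t] times the denominator of [l], hence the
    bit sizes of thresholds grow by a factor [1 + L * 2 ^ L] per nesting level
    and remain singly exponential, as does the number of thresholds. *)

(* [seq.suffix] hides the suffix of a computation. *)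
Local Notation suffix := Defs.suffix.

(** * Finite automata from closed transition systems *)

Section BooleanFormulas.
Variable Q : Type.
Implicit Types (b c : pbf Q) (P : Q -> Prop).

(** Satisfaction by an arbitrary predicate, so that truth on a suffix of the computation can serve
    as an assignment; [pbf_sat_map] links it to the finite successor sets of a run. *)
Fixpoint bsat P b : Prop :=
  match b with
  | PTrue => True
  | PFalse => False
  | PVar q => P q
  | PAnd b1 b2 => bsat P b1 /\ bsat P b2
  | POr b1 b2 => bsat P b1 \/ bsat P b2
  end.

Fixpoint pbf_map (Q' : Type) (e : Q -> Q') b : pbf Q' :=
  match b with
  | PTrue => @PTrue Q'
  | PFalse => @PFalse Q'
  | PVar q => PVar (e q)
  | PAnd b1 b2 => PAnd (pbf_map e b1) (pbf_map e b2)
  | POr b1 b2 => POr (pbf_map e b1) (pbf_map e b2)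
  end.

Definition pbool (x : bool) : pbf Q := if x then @PTrue Q else @PFalse Q.
(** The polarity [s] selects the connective, so that an assertion and its dual share one definition
    and one proof. *)
Definition psel (s : bool) b c := if s then POr b c else PAnd b c.
Definition bop (s x y : bool) := if s then x || y else x && y.

Lemma bsat_bool P x : bsat P (pbool x) <-> x.
Proof. by case: x. Qed.

Lemma bsat_sel P s b c (x y : bool) :
  (bsat P b <-> x) -> (bsat P c <-> y) -> (bsat P (psel s b c) <-> bop s x y).
Proof.
rewrite /psel /bop; case: s => /= -> ->; first by split=> /orP.
by split=> /andP.
Qed.

Lemma pbf_atoms_map (Q' : Type) (e : Q -> Q') b :
  pbf_atoms (pbf_map e b) = map e (pbf_atoms b).
Proof. by elim: b => //= b1 -> b2 ->; rewrite map_cat. Qed.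

Lemma pbf_atoms_sel s b c : pbf_atoms (psel s b c) = pbf_atoms b ++ pbf_atoms c.
Proof. by case: s. Qed.

Lemma pbf_atoms_bool x : pbf_atoms (pbool x) = [::].
Proof. by case: x. Qed.

Lemma pbf_sat_map (Q' : finType) (e : Q -> Q') (D : {set Q'}) b :
  pbf_sat D (pbf_map e b) <-> bsat (fun q => e q \in D) b.
Proof.
elim: b => //= b1 IH1 b2 IH2; first by rewrite -IH1 -IH2; split=> /andP.
by rewrite -IH1 -IH2; split=> /orP.
Qed.

End BooleanFormulas.

Section BooleanFormulasEq.
Variable Q : eqType.
Implicit Types (b : pbf Q) (P : Q -> Prop).

Lemma bsat_mono P P' b :
  (forall q, q \in pbf_atoms b -> P q -> P' q) -> bsat P b -> bsat P' b.
Proof.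
elim: b => //= [q H|b1 IH1 b2 IH2 H|b1 IH1 b2 IH2 H].
- by apply: H; rewrite mem_head.
- by case=> ? ?; split; [apply: IH1|apply: IH2] => // q qb; apply: H; rewrite mem_cat qb ?orbT.
- by case=> ?; [left; apply: IH1|right; apply: IH2] => // q qb; apply: H; rewrite mem_cat qb ?orbT.
Qed.

(** Positive formulas are monotone, so a loss of satisfaction is witnessed by a single atom. This is
    what lets a false assertion be followed along a run. *)
Lemma bsat_differ P P' b : bsat P b -> ~ bsat P' b ->
  exists q, [/\ q \in pbf_atoms b, P q & ~ P' q].
Proof.
move=> sP nP'; apply: contrapT => nq; apply: nP'; apply: bsat_mono sP => q qb Pq.
by apply: contrapT => nP'; apply: nq; exists q.
Qed.

End BooleanFormulasEq.

(** Each real change of [p] strictly shrinks the set of elements below the current one; induction is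
    on the size of that set. *)
Lemma descending_eventually_constant (T : finType) (lt : rel T) (p : nat -> T) :
  irreflexive lt -> transitive lt ->
  (forall k, p k.+1 = p k \/ lt (p k.+1) (p k)) ->
  exists m, forall k, p (m + k)%N = p m.
Proof.
move=> irr tr step.
suff: forall n m, (#|[pred x | lt x (p m)]| < n)%N ->
    exists m', forall k, p (m' + k)%N = p m'.
  by move/(_ _ 0%N (ltnSn _)).
elim=> [//|n IH] m; rewrite ltnS => le_n.
have [cst|] := pselect (forall k, p (m + k)%N = p m); first by exists m.
move=> ncst.
have : exists k, ~~ (p (m + k)%N == p m).
  apply: contrapT => H; apply: ncst => k; apply/eqP/negPn/negP => nk.
  by apply: H; exists k.
(* At the first index where [p] leaves [p m], its predecessor is still [p m], so that step
   descends. *)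
move=> exk; have := ex_minnP exk; case=> -[|k]; rewrite ?addn0 ?eqxx// => neq kmin.
have /negPn/eqP eqk : ~~ ~~ (p (m + k)%N == p m).
  by apply/negP => /kmin; rewrite ltnn.
have ltk : lt (p (m + k.+1)%N) (p m).
  case: (step (m + k)%N); rewrite -addnS eqk // => eqk1.
  by rewrite eqk1 eqxx in neq.
apply: (IH (m + k.+1)%N); apply: leq_trans le_n; apply: proper_card.
apply/properP; split; first by apply/fintype.subsetP => x; rewrite !inE => /tr; apply.
by exists (p (m + k.+1)%N); rewrite !inE ?irr.
Qed.

Section FiniteAutomaton.
Variables (Sigma : finType) (Q : eqType) (S : seq Q) (q0 : Q).
Variables (d : Q -> Sigma -> pbf Q) (F : pred Q) (lt : rel Q).
Hypotheses (uS : uniq S) (q0S : q0 \in S).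
Hypothesis (dS : forall q a q', q \in S -> q' \in pbf_atoms (d q a) -> q' \in S).
Hypotheses (lt_irr : irreflexive lt) (lt_tr : transitive lt).
Hypothesis (d_lt : forall q a q', q \in S -> q' \in pbf_atoms (d q a) ->
  q' = q \/ lt q' q).

(** States are positions in [S], so the number of states is [size S] by construction. *)
Definition decode (i : 'I_(size S)) : Q := nth q0 S i.

Let init : 'I_(size S) := Ordinal (eq_ind_r is_true q0S (index_mem q0 S)).

Definition encode (q : Q) : 'I_(size S) := insubd init (index q S).

Lemma encodeK q : q \in S -> decode (encode q) = q.
Proof. by move=> qS; rewrite /decode val_insubd index_mem qS nth_index. Qed.

Lemma decodeK i : encode (decode i) = i.
Proof. by apply: val_inj; rewrite val_insubd /decode index_uniq // ltn_ord. Qed.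

Lemma decode_mem i : decode i \in S.
Proof. exact: mem_nth. Qed.

Definition finite_automaton : ABA Sigma :=
  {| states := 'I_(size S); q_in := encode q0;
     delta := fun i a => pbf_map encode (d (decode i) a);
     acc := [set i | F (decode i)] |}.

Local Notation A := finite_automaton.

Lemma card_finite_automaton : #|states A| = size S.
Proof. exact: card_ord. Qed.

(** Every state forms a class of its own, ordered by the reflexive closure of [lt]. *)
Lemma finite_automaton_weak : weak A.
Proof.
exists (fun i : 'I_(size S) => i : nat),
  (fun m n => (m == n) || lt (nth q0 S m) (nth q0 S n)).
split; first by move=> m; rewrite eqxx.
split.
  move=> m n /andP[/orP[/eqP//|mn] /orP[/eqP//|nm]].
  by have := lt_tr mn nm; rewrite lt_irr.
split.
  move=> n m k /orP[/eqP->//|mn] /orP[/eqP<-|nk]; first by rewrite mn orbT.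
  by rewrite (lt_tr mn nk) orbT.
split=> [i j /val_inj -> //|i a j]; rewrite /= pbf_atoms_map => /mapP[q qa ->].
have qS := dS (decode_mem i) qa.
case: (d_lt (decode_mem i) qa) => [->|lt_qi]; first by rewrite decodeK eqxx.
by rewrite -[nth _ _ (encode q)]/(decode (encode q)) encodeK // lt_qi orbT.
Qed.

(** Each step stays put or descends in [lt], so infinite paths are eventually constant and
    acceptance has to be checked only on states that loop forever. [G] is an invariant of the
    reachable nodes and [r] the chosen successor relation. *)
Lemma finite_automaton_accepts (w : nat -> Sigma)
    (G : nat -> Q -> Prop) (r : nat -> Q -> Q -> Prop) :
  G 0%N q0 ->
  (forall l q q', G l q -> r l q q' -> G l.+1 q') ->
  (forall l q, q \in S -> G l q -> bsat (r l q) (d q (w l))) ->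
  (forall l q q', r l q q' -> q' \in pbf_atoms (d q (w l))) ->
  (forall l q, q \in S -> G l q -> (forall k, r (l + k)%N q q) -> F q) ->
  accepts A w.
Proof.
move=> G0 Gr sat_r r_atoms cstF.
pose rA l (i : states A) : {set states A} := [set j | `[< r l (decode i) (decode j) >]].
exists rA; have pG (p : nat -> states A) n : p 0%N = q_in A ->
    (forall k, (k < n)%N -> p k.+1 \in rA k (p k)) -> G n (decode (p n)).
  move=> p0; elim: n => [_|n IH pr]; first by rewrite p0 encodeK.
  have := pr n (ltnSn n); rewrite inE => /asboolP; apply: Gr.
  by apply: IH => k kn; apply: pr; rewrite ltnS ltnW.
split=> [l i [p [p0 [<- pr]]]|p p0 pr n].
  apply/pbf_sat_map; have := sat_r _ _ (decode_mem (p l)) (pG p l p0 pr).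
  apply: bsat_mono => q qa rq; rewrite inE; apply/asboolP.
  by rewrite encodeK //; apply: dS qa; exact: decode_mem.
have [||k|m cst] := @descending_eventually_constant _
    (fun i j => lt (decode i) (decode j)) p.
- by move=> i; exact: lt_irr.
- by move=> j i k; exact: lt_tr.
- have := pr k; rewrite inE => /asboolP /r_atoms /(d_lt (decode_mem _)) [eqk|]; last by right.
  by left; rewrite -[LHS]decodeK eqk decodeK.
exists (m + n)%N; rewrite leq_addl; split=> //; rewrite cst inE.
apply: (cstF m); first exact: decode_mem.
  by apply: pG => // k _; exact: pr.
move=> k; have := pr (m + k)%N; rewrite inE => /asboolP.
by rewrite -addnS !cst.
Qed.

(** [G] is reachability in the run. A path from any reachable node can be prefixed by the history
    that reaches it, so acceptance applies to it although it is stated for paths from the root. *)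
Lemma finite_automaton_accepted (w : nat -> Sigma) : accepts A w ->
  exists (G : nat -> Q -> Prop) (r : nat -> Q -> Q -> Prop),
  [/\ G 0%N q0, forall l q, G l q -> q \in S,
      forall l q q', G l q -> r l q q' -> G l.+1 q',
      forall l q, G l q -> bsat (r l q) (d q (w l)) &
      forall l (p : nat -> Q), G l (p 0%N) ->
        (forall k, r (l + k)%N (p k) (p k.+1)) -> exists k, F (p k)].
Proof.
move=> [rA [runA accA]].
exists (fun l q => q \in S /\ reachable A rA l (encode q)),
  (fun l q q' => q' \in S /\ encode q' \in rA l (encode q)).
split.
- by split=> //; exists (fun=> encode q0).
- by move=> l q [].
- move=> l q q' [_ [p [p0 [pl pr]]]] [q'S rq']; split=> //.
  exists (fun k => if (k <= l)%N then p k else encode q').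
  split=> //; split=> [|k]; first by rewrite ltnn.
  rewrite ltnS => kl; rewrite kl; have [lt_kl|] := ltnP k l; first exact: pr.
  by move=> lk; have -> : k = l; [apply/eqP; rewrite eqn_leq kl lk|rewrite pl].
- move=> l q [qS rq]; have := runA _ _ rq.
  rewrite /= => /pbf_sat_map; rewrite encodeK //.
  by apply: bsat_mono => q' q'a q'r; split=> //; exact: dS q'a.
move=> l p [p0S [p' [p'0 [p'l p'r]]]] pr.
have pS k : p k \in S by case: k => // k; case: (pr k).
pose path k := if (k <= l)%N then p' k else encode (p (k - l)%N).
have [||n [ln]] := accA path _ _ l.
- exact: p'0.
- move=> k; rewrite /path; have [lt_kl|lt_lk|->] := ltngtP k l.
  + exact: p'r.
  + by have [_] := pr (k - l)%N; rewrite subnKC 1?ltnW // subSn 1?ltnW.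
  + by have [_] := pr 0%N; rewrite addn0 p'l subSnn.
rewrite inE /path; move: ln; rewrite leq_eqVlt => /orP[/eqP <-|ln].
  by rewrite leqnn p'l encodeK // => ?; exists 0%N.
by rewrite leqNgt ln /= encodeK // => ?; exists (n - l)%N.
Qed.

End FiniteAutomaton.

(** * Values of discounted until *)

Section DiscountedUntil.
Variable R : realType.
Implicit Types (l t : R) (a b : nat -> R).

Definition uterm l a b (i : nat) : R :=
  Num.min (l ^+ i * b i) (\big[Num.min/1]_(j < i) (l ^+ j * a j)).

Local Open Scope classical_set_scope.
Definition uval l a b : R := sup [set uterm l a b i | i in [set: nat]].
Local Close Scope classical_set_scope.

(** The bound on [t] is there because the minimum over an empty range is 1. *)
Lemma le_uterm t l a b i : t <= 1 ->
  t <= uterm l a b i <->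
  t <= l ^+ i * b i /\ forall j, (j < i)%N -> t <= l ^+ j * a j.
Proof.
move=> t1; rewrite /uterm le_min; split=> [/andP[-> /bigmin_geP[_ H]]|[-> H]] /=.
  by split=> // j ji; exact: (H (Ordinal ji)).
by apply/bigmin_geP; split=> // j _; exact: H.
Qed.

Lemma lt_uterm t l a b i : t < 1 ->
  t < uterm l a b i <->
  t < l ^+ i * b i /\ forall j, (j < i)%N -> t < l ^+ j * a j.
Proof.
move=> t1; rewrite /uterm lt_min; split=> [/andP[-> /bigmin_gtP[_ H]]|[-> H]] /=.
  by split=> // j ji; exact: (H (Ordinal ji)).
by apply/bigmin_gtP; split=> // j _; exact: H.
Qed.

Section Bounds.
Variables (l : R) (a b : nat -> R).
Hypotheses (l01 : 0 < l <= 1).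
Hypotheses (a01 : forall i, 0 <= a i <= 1) (b01 : forall i, 0 <= b i <= 1).

Lemma discount_le1 i (x : R) : 0 <= x <= 1 -> 0 <= l ^+ i * x <= x.
Proof.
case/andP: l01 => /ltW l0 l1 /andP[x0 x1].
by rewrite mulr_ge0 ?exprn_ge0 //= ler_piMl // exprn_ile1.
Qed.

Lemma uterm01 i : 0 <= uterm l a b i <= 1.
Proof.
apply/andP; split; last first.
  rewrite /uterm ge_min; have /andP[_ H] := discount_le1 i (b01 i).
  by rewrite (le_trans H) //; case/andP: (b01 i).
apply/le_uterm => //; split=> [|j _].
  by case/andP: (discount_le1 i (b01 i)).
by case/andP: (discount_le1 j (a01 j)).
Qed.

Lemma uval_ub i : uterm l a b i <= uval l a b.
Proof.
apply: ub_le_sup; last by exists i.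
by exists 1 => _ [j _ <-]; case/andP: (uterm01 j).
Qed.

Lemma uval_le t : (forall i, uterm l a b i <= t) -> uval l a b <= t.
Proof. by move=> H; apply: ge_sup => [|_ [i _ <-]]; [exists (uterm l a b 0%N); exists 0%N|]. Qed.

Lemma uval01 : 0 <= uval l a b <= 1.
Proof.
have /andP[t0 _] := uterm01 0; rewrite (le_trans t0 (uval_ub 0)) /=.
by apply: uval_le => i; case/andP: (uterm01 i).
Qed.

(** A number strictly below a supremum is below one of the terms, whether or not the supremum is
    attained. *)
Lemma lt_uval t : t < uval l a b <->
  exists i, t < l ^+ i * b i /\ forall j, (j < i)%N -> t < l ^+ j * a j.
Proof.
split=> [tu|[i H]].
  have t1 : t < 1 by apply: lt_le_trans tu _; case/andP: uval01.
  have [i ti] : exists i, t < uterm l a b i.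
    apply: contrapT => nt; move: tu; rewrite ltNge => /negP; apply.
    by apply: uval_le => i; rewrite leNgt; apply/negP => ti; apply: nt; exists i.
  by exists i; apply/lt_uterm.
apply: lt_le_trans (uval_ub i); apply/lt_uterm => //.
case: H => /lt_le_trans + _; apply.
have /andP[_ /le_trans] := discount_le1 i (b01 i); apply.
by case/andP: (b01 i).
Qed.

End Bounds.

(** Both sides have the same strict lower bounds: index 0 gives [b 0], and index [i.+1] is index [i]
    of the shifted sequences with the bound divided by [l]. *)
Lemma uval_rec l a b : 0 < l <= 1 ->
  (forall i, 0 <= a i <= 1) -> (forall i, 0 <= b i <= 1) ->
  uval l a b = Num.max (b 0%N)
    (Num.min (a 0%N) (l * uval l (fun i => a i.+1) (fun i => b i.+1))).
Proof.
move=> l01 a01 b01; have /andP[l0 _] := l01.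
have lt_ext (x y : R) : (forall t, t < x <-> t < y) -> x = y.
  move=> H; apply/eqP; rewrite eq_le !leNgt; apply/andP.
  by split; apply/negP => /H; rewrite ltxx.
apply: lt_ext => t; rewrite lt_max lt_min mulrC -ltr_pdivrMr //.
have shift i x : (t / l < l ^+ i * x) = (t < l ^+ i.+1 * x).
  by rewrite ltr_pdivrMr // mulrC mulrA -exprS.
split=> [/lt_uval|]; first case=> // -[|i] [tb ta].
- by rewrite expr0 mul1r in tb; rewrite tb.
- apply/orP; right; have := ta 0%N isT; rewrite expr0 mul1r => -> /=.
  apply/lt_uval => //; exists i; rewrite shift; split=> // j ji.
  by rewrite shift; exact: ta.
case/orP=> [tb|/andP[ta /lt_uval]].
  by apply/lt_uval => //; exists 0%N; rewrite expr0 mul1r.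
case=> // i [tb ta']; apply/lt_uval => //; exists i.+1; rewrite -shift; split=> // -[_|j ji].
  by rewrite expr0 mul1r.
by rewrite -shift; exact: ta'.
Qed.

(* Beyond [m], shifting the index by the period [p] only adds constraints to
   the term, so the supremum is a maximum over the first [m + p] indices. *)
Lemma uval_attained a b (m p : nat) t : (0 < p)%N ->
  (forall i, 0 <= a i <= 1) -> (forall i, 0 <= b i <= 1) ->
  (forall i, (m <= i)%N -> b (i + p)%N = b i) ->
  t <= 1 -> t <= uval 1 a b ->
  exists i, t <= b i /\ forall j, (j < i)%N -> t <= a j.
Proof.
move=> p0 a01 b01 bper t1 tu.
have l01 : 0 < (1 : R) <= 1 by rewrite ltr01 /=.
have termS i : (m <= i)%N -> uterm 1 a b (i + p) <= uterm 1 a b i.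
  move=> mi; have /andP[_ u1] := uterm01 l01 a01 b01 (i + p)%N.
  have [+ ua] := (le_uterm 1 a b (i + p)%N u1).1 (lexx _).
  rewrite expr1n mul1r bper // => ub; apply/le_uterm => //; rewrite expr1n mul1r.
  by split=> // j ji; apply: ua; rewrite ltn_addr.
(* By [termS] every later term is dominated by one a period earlier, so [M] bounds them all. *)
pose M := \big[Num.max/0]_(i < m + p) uterm 1 a b i.
have leM i : uterm 1 a b i <= M.
  elim/ltn_ind: i => i IH; have [ilt|] := ltnP i (m + p)%N.
    exact: (@le_bigmax _ _ _ 0 (fun i : 'I_(m + p) => uterm 1 a b i) (Ordinal ilt)).
  move=> ige; have ip : (p <= i)%N by apply: leq_trans ige; rewrite leq_addl.
  have := termS (i - p)%N; rewrite subnK // => /(_ _)/le_trans; apply.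
    by rewrite leq_subRL // addnC.
  by apply: IH; rewrite ltn_subrL p0 (leq_trans p0 ip).
have [i ti] : exists i, t <= uterm 1 a b i.
  apply: contrapT => nt.
  have ltt i : uterm 1 a b i < t by rewrite ltNge; apply/negP => ?; apply: nt; exists i.
  have /andP[u0 _] := uterm01 l01 a01 b01 0.
  have : M < t.
    by apply: bigmax_lt => [|i _]; [exact: le_lt_trans u0 (ltt 0%N)|exact: ltt].
  by rewrite ltNge (le_trans tu) // uval_le.
have [tb ta] := (le_uterm 1 a b i t1).1 ti.
exists i; rewrite expr1n mul1r in tb; split=> // j /ta.
by rewrite expr1n mul1r.
Qed.

End DiscountedUntil.

(** * Unfolding of assertions *)

Section Semantics.
Variables (R : realType) (AP : finType).
Implicit Types (f g h : formula AP) (pi : computation AP) (l t : rat).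

Lemma suffix_add pi i j : suffix (suffix pi i) j = suffix pi (i + j).
Proof. by apply: funext => k; rewrite /suffix addnA. Qed.

Lemma sem_untilD l g h pi : sem R (FUntilD l g h) pi =
  uval (ratr l) (fun i => sem R g (suffix pi i)) (fun i => sem R h (suffix pi i)).
Proof. by []. Qed.

Lemma sem_until g h pi : sem R (FUntil g h) pi =
  uval (ratr 1) (fun i => sem R g (suffix pi i)) (fun i => sem R h (suffix pi i)).
Proof.
rewrite /= /uval /uterm rmorph1; congr sup; congr image; apply: funext => i.
rewrite expr1n mul1r; congr Num.min; apply: eq_bigr => j _.
by rewrite expr1n mul1r.
Qed.

Lemma ratr01 l : 0 < l <= 1 -> 0 < (ratr l : R) <= 1.
Proof. by rewrite ltr0q -(ler_rat R) rmorph1. Qed.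

Lemma sem01 f pi : wf f -> 0 <= sem R f pi <= 1.
Proof.
elim: f pi => [|p|g IHg|g IHg h IHh|g IHg|g IHg h IHh|l g IHg h IHh] pi.
- by rewrite /= ler01 lexx.
- by rewrite /=; case: ifP; rewrite ?ler01 lexx.
- by move=> /= /(IHg pi) /andP[g0 g1]; rewrite subr_ge0 g1 gerBl.
- move=> /= /andP[/(IHg pi) /andP[g0 g1] /(IHh pi) /andP[h0 h1]].
  by rewrite le_max g0 ge_max g1 h1.
- by move=> /= /IHg; apply.
- case/andP=> wg wh; rewrite sem_until; apply: uval01 => *; rewrite ?IHg ?IHh //.
  exact: ratr01.
- case/and4P=> l0 l1 wg wh; rewrite sem_untilD; apply: uval01 => *; rewrite ?IHg ?IHh //.
  by apply: ratr01; rewrite l0 ltW.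
Qed.

Definition cmp (s : bool) t (x : R) : bool := if s then ratr t < x else x < ratr t.

Lemma cmp_max s t x y : cmp s t (Num.max x y) = bop s (cmp s t x) (cmp s t y).
Proof. by case: s; rewrite /= ?lt_max ?gt_max. Qed.

Lemma cmp_min s t x y : cmp s t (Num.min x y) = bop (~~ s) (cmp s t x) (cmp s t y).
Proof. by case: s; rewrite /= ?lt_min ?gt_min. Qed.

Lemma cmp_opp s t x : cmp s t (1 - x) = cmp (~~ s) (1 - t) x.
Proof. by case: s; rewrite /= rmorphB rmorph1 ?ltrBrDr ?ltrBlDr addrC. Qed.

Lemma cmp_mul s t l x : 0 < l -> cmp s t (ratr l * x) = cmp s (t / l) x.
Proof.
move=> l0; have l0' : 0 < ratr l :> R by rewrite ltr0q.
rewrite /cmp fmorph_div [ratr l * x]mulrC; case: s.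
  by rewrite (ltr_pdivrMr _ _ l0').
by rewrite (ltr_pdivlMr _ _ l0').
Qed.

Lemma cmp_gt1 s t x : 0 <= x <= 1 -> 1 < t -> cmp s t x = ~~ s.
Proof.
case/andP=> x0 x1; rewrite -(ltr_rat R) rmorph1 => /(le_lt_trans x1) xt.
by case: s => //=; apply/negbTE; rewrite -leNgt ltW.
Qed.

End Semantics.

Section Transitions.
Variable AP : finType.
Implicit Types (f g h : formula AP) (pi : computation AP) (l t : rat).

(* [(f, true, t)] asserts that the value of [f] is above [t], and
   [(f, false, t)] that it is below. *)
Definition assertion : Type := formula AP * bool * rat.

(** This is [uval_rec] with the discount moved into the threshold. Once [t / l] exceeds 1 the
    remaining assertion is constant by [cmp_gt1], which keeps the set of states finite. *)
Definition expand_until f s t l (dg dh : pbf assertion) : pbf assertion :=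
  psel s dh (psel (~~ s) dg
    (if t / l <= 1 then PVar (f, s, t / l) else pbool _ (~~ s))).

(** Only next and the self-reference of an until produce states; all other connectives are resolved
    while the current letter is read. *)
Fixpoint expand f (s : bool) t (a : {set AP}) : pbf assertion :=
  match f with
  | FTrue => pbool _ (if s then t < 1 else 1 < t)
  | FAtom p => let x := if p \in a then 1 else 0 in
               pbool _ (if s then t < x else x < t)
  | FNot g => expand g (~~ s) (1 - t) a
  | FOr g h => psel s (expand g s t a) (expand h s t a)
  | FNext g => PVar (g, s, t)
  | FUntil g h => expand_until f s t 1 (expand g s t a) (expand h s t a)
  | FUntilD l g h => expand_until f s t l (expand g s t a) (expand h s t a)
  end.

Definition assertion_step (q : assertion) a := expand q.1.1 q.1.2 q.2 a.

Fixpoint fweight f : nat :=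
  match f with
  | FTrue | FAtom _ => 1
  | FNot g | FNext g => (fweight g).+1
  | FOr g h | FUntil g h | FUntilD _ g h => (fweight g + fweight h).+1
  end.

Definition until_parts f : option (rat * formula AP * formula AP) :=
  match f with
  | FUntil g h => Some (1, g, h)
  | FUntilD l g h => Some (l, g, h)
  | _ => None
  end.

Lemma until_partsP f l g h : until_parts f = Some (l, g, h) -> wf f ->
  [/\ 0 < l <= 1, wf g, wf h, (fweight g < fweight f)%N & (fweight h < fweight f)%N].
Proof.
case: f => //= [f1 f2 [<- <- <-] /andP[-> ->]|l' f1 f2 [<- <- <-] /and4P[-> l1 -> ->]].
  by rewrite !ltnS leq_addr leq_addl.
by rewrite (ltW l1) !ltnS leq_addr leq_addl.
Qed.

Lemma expand_untilE f l g h s t a : until_parts f = Some (l, g, h) ->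
  expand f s t a = expand_until f s t l (expand g s t a) (expand h s t a).
Proof. by case: f => //= [f1 f2 [<- <- <-]|l' f1 f2 [<- <- <-]]. Qed.

Lemma sem_untilE (R : realType) f l g h pi : until_parts f = Some (l, g, h) ->
  sem R f pi =
  uval (ratr l) (fun i => sem R g (suffix pi i)) (fun i => sem R h (suffix pi i)).
Proof. by case: f => // [f1 f2 [<- <- <-]|l' f1 f2 [<- <- <-]]; rewrite ?sem_until. Qed.

(** Every transition goes to a lighter formula, except for the self-reference of an until. *)
Lemma expand_atoms f s t a q : q \in pbf_atoms (expand f s t a) ->
  (fweight q.1.1 < fweight f)%N \/
  exists l g h, [/\ until_parts f = Some (l, g, h), t / l <= 1 & q = (f, s, t / l)].
Proof.
have until_atoms f' l g h : until_parts f' = Some (l, g, h) ->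
    (forall s t, q \in pbf_atoms (expand g s t a) -> (fweight q.1.1 <= fweight g)%N) ->
    (forall s t, q \in pbf_atoms (expand h s t a) -> (fweight q.1.1 <= fweight h)%N) ->
    q \in pbf_atoms (expand f' s t a) ->
    (fweight q.1.1 <= fweight g + fweight h)%N \/
    exists l g h, [/\ until_parts f' = Some (l, g, h), t / l <= 1 & q = (f', s, t / l)].
  move=> fE IHg IHh; rewrite (expand_untilE _ _ _ fE) /expand_until !pbf_atoms_sel !mem_cat.
  case/or3P=> [/IHh qh|/IHg qg|].
  - by left; rewrite (leq_trans qh) // leq_addl.
  - by left; rewrite (leq_trans qg) // leq_addr.
  by case: ifP => [tl|_]; rewrite ?pbf_atoms_bool // inE => /eqP ->; right; exists l, g, h.
(* The non-strict bound passes through induction; the top symbol then makes it strict. *)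
have le_atoms f' s' t' : q \in pbf_atoms (expand f' s' t' a) ->
    (fweight q.1.1 <= fweight f')%N.
  elim: f' s' t' => [|p|g IHg|g IHg h IHh|g IHg|g IHg h IHh|l g IHg h IHh] s' t' /=;
    rewrite /expand_until ?pbf_atoms_bool ?pbf_atoms_sel ?mem_cat //.
  - by move/IHg/leq_trans; apply.
  - by case/orP=> [/IHg|/IHh] /leq_trans; apply; rewrite ltnW // ltnS ?leq_addr ?leq_addl.
  - by rewrite inE => /eqP ->.
  - case/or3P=> [/IHh|/IHg|].
    + by move/leq_trans; apply; rewrite ltnW // ltnS leq_addl.
    + by move/leq_trans; apply; rewrite ltnW // ltnS leq_addr.
    + by case: ifP => _; rewrite ?pbf_atoms_bool // inE => /eqP ->.
  - case/or3P=> [/IHh|/IHg|].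
    + by move/leq_trans; apply; rewrite ltnW // ltnS leq_addl.
    + by move/leq_trans; apply; rewrite ltnW // ltnS leq_addr.
    + by case: ifP => _; rewrite ?pbf_atoms_bool // inE => /eqP ->.
case: f => [|p|g|g h|g|g h|l g h].
- by rewrite /= pbf_atoms_bool.
- by rewrite /= pbf_atoms_bool.
- by move=> /= /le_atoms qle; left; rewrite ltnS.
- by rewrite /= pbf_atoms_sel mem_cat => /orP[]/le_atoms qle; left; rewrite /= ltnS
    (leq_trans qle) ?leq_addr ?leq_addl.
- by rewrite inE => /eqP ->; left.
- by apply: (until_atoms (FUntil g h) 1 g h) => //; exact: le_atoms.
- by apply: (until_atoms (FUntilD l g h) l g h) => //; exact: le_atoms.
Qed.

Section Holds.
Variable R : realType.

Definition holds pi (q : assertion) : bool := cmp q.1.2 q.2 (sem R q.1.1 pi).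

(** Maximum and minimum become the connectives of [psel], exchanged for the polarity below. No
    property of the whole computation enters, so the equivalence holds in both directions. *)
Lemma expand_exact f s t pi : wf f ->
  bsat (holds (suffix pi 1)) (expand f s t (pi 0%N)) <-> cmp s t (sem R f pi).
Proof.
have until_exact f' l g h s' t' : until_parts f' = Some (l, g, h) -> wf f' ->
    (bsat (holds (suffix pi 1)) (expand g s' t' (pi 0%N)) <-> cmp s' t' (sem R g pi)) ->
    (bsat (holds (suffix pi 1)) (expand h s' t' (pi 0%N)) <-> cmp s' t' (sem R h pi)) ->
    bsat (holds (suffix pi 1)) (expand f' s' t' (pi 0%N)) <-> cmp s' t' (sem R f' pi).
  move=> fE wf' IHg IHh; have [l01 wg wh _ _] := until_partsP fE wf'.
  rewrite (expand_untilE _ _ _ fE) (sem_untilE _ _ fE) uval_rec; last first.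
  - by move=> i; exact: sem01.
  - by move=> i; exact: sem01.
  - exact: ratr01.
  rewrite cmp_max cmp_min cmp_mul; last by case/andP: l01.
  apply: bsat_sel => //; apply: bsat_sel => //.
  have -> : uval (ratr l) (fun i => sem R g (suffix pi i.+1))
      (fun i => sem R h (suffix pi i.+1)) = sem R f' (suffix pi 1).
    by rewrite (sem_untilE _ _ fE); congr uval; apply: funext => i; rewrite suffix_add add1n.
  have [//|tl] := leP (t' / l) 1; rewrite cmp_gt1 ?sem01 //; exact: bsat_bool.
elim: f s t => [|p|g IHg|g IHg h IHh|g IHg|g IHg h IHh|l g IHg h IHh] s t wff.
- by rewrite bsat_bool /cmp; case: s; rewrite /= -(ltr_rat R) rmorph1.
- rewrite bsat_bool /cmp /=; case: (p \in pi 0%N).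
    by case: s; rewrite /= -(ltr_rat R) rmorph1.
  by case: s; rewrite /= ?ltrq0 ?ltr0q.
- by rewrite [expand _ _ _ _]/= [sem _ _ _]/= cmp_opp; exact: IHg.
- case/andP: wff => wg wh; rewrite [expand _ _ _ _]/= [sem _ _ _]/= cmp_max.
  by apply: bsat_sel; [exact: IHg|exact: IHh].
- by [].
- by case/andP: (wff) => wg wh; apply: (until_exact _ 1 g h) => //; [exact: IHg|exact: IHh].
- by case/and4P: (wff) => _ _ wg wh; apply: (until_exact _ l g h) => //; [exact: IHg|exact: IHh].
Qed.

End Holds.
End Transitions.

(** * Correctness *)

Lemma lasso_periodic (AP : finType) (pi : computation AP) : lasso pi ->
  exists m p, (0 < p)%N /\ forall i, (m <= i)%N -> suffix pi (i + p) = suffix pi i.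
Proof.
move=> [u [w [w0 piE]]]; exists (size u), (size w); split; first by rewrite lt0n size_eq0.
move=> i ui; apply: funext => k; rewrite /suffix !piE.
have -> : (i + size w + k < size u)%N = false.
  by apply/negbTE; rewrite -leqNgt -addnA (leq_trans ui) // leq_addr.
have -> : (i + k < size u)%N = false.
  by apply/negbTE; rewrite -leqNgt (leq_trans ui) // leq_addr.
by rewrite addnAC -addnBAC ?modnDr // (leq_trans ui) // leq_addr.
Qed.

Section Correctness.
Variables (AP : finType) (S : seq (assertion AP)) (q0 : assertion AP).

(** The accepting states: staying forever in an undiscounted until asserted to be below [t] is
    legitimate, since every term may have to be refuted. *)
Definition until_below (q : assertion AP) : bool :=
  if q.1.1 is FUntil _ _ then ~~ q.1.2 else false.

(** Lexicographic, with larger thresholds counted as smaller because a self-reference divides [t] by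
    a number at most 1. *)
Definition assertion_lt (q' q : assertion AP) : bool :=
  (fweight q'.1.1 < fweight q.1.1)%N ||
  (fweight q'.1.1 == fweight q.1.1) && (q.2 < q'.2).

Hypotheses (uS : uniq S) (q0S : q0 \in S).
Hypothesis dS : forall q a q', q \in S -> q' \in pbf_atoms (assertion_step q a) -> q' \in S.
Hypothesis S_wf : forall q, q \in S -> wf q.1.1 && (0 <= q.2).

Lemma assertion_lt_irr : irreflexive assertion_lt.
Proof. by move=> q; rewrite /assertion_lt ltnn ltxx andbF. Qed.

Lemma assertion_lt_trans : transitive assertion_lt.
Proof.
move=> q2 q1 q3; rewrite /assertion_lt.
case/orP=> [w12|/andP[/eqP -> t12]] /orP[w23|/andP[/eqP w23 t23]].
- by rewrite (ltn_trans w12).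
- by rewrite -w23 w12.
- by rewrite w23.
- by rewrite w23 eqxx (lt_trans t23 t12) orbT.
Qed.

Lemma assertion_step_lt q a q' : q \in S -> q' \in pbf_atoms (assertion_step q a) ->
  q' = q \/ assertion_lt q' q.
Proof.
case: q => -[f s] t /S_wf/= /andP[wff t0] /expand_atoms [w|[l [g [h [fE tl ->]]]]].
  by right; rewrite /assertion_lt w.
have [/andP[l0 l1] _ _ _ _] := until_partsP fE wff.
rewrite /assertion_lt /= eqxx ltnn /=.
have : t <= t / l by rewrite ler_peMr // invf_ge1.
by rewrite le_eqVlt => /predU1P[<-|]; [left|right].
Qed.

Let A := finite_automaton (@assertion_step AP) until_below q0S.

Section Computation.
Variables (R : realType) (pi : computation AP).
Local Notation holds l q := (holds R (suffix pi l) q).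

Lemma assertion_step_exact l q : wf q.1.1 ->
  bsat (fun q' => holds l.+1 q') (assertion_step q (pi l)) <-> holds l q.
Proof.
move=> wfq; have := expand_exact R q.1.2 q.2 (suffix pi l) wfq.
by rewrite suffix_add addn1 /suffix addn0.
Qed.

(* An assertion that a value of [g U h] is above [t] is discharged as soon as
   [h] itself exceeds [t]; cutting its self-loop there makes the run accepting. *)
Definition discharged l (q : assertion AP) : bool :=
  if until_parts q.1.1 is Some (_, _, h) then q.1.2 && holds l (h, true, q.2)
  else false.

(** The run moves to all true atoms of the unfolding, without the loops at discharged assertions;
    what remains is to rule out non-accepting eternal loops. *)
Lemma above_accepted : holds 0%N q0 -> accepts A pi.
Proof.
move=> h0; apply: (finite_automaton_accepts uS q0S dS assertion_lt_irr assertion_lt_trans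
  assertion_step_lt (G := fun l q => holds l q)
  (r := fun l q q' => [/\ q' \in pbf_atoms (assertion_step q (pi l)), holds l.+1 q' &
                        ~ (q' = q /\ discharged l q)])).
- exact: h0.
- by move=> l q q' _ [].
- move=> l q qS hq; have /andP[wfq _] := S_wf qS.
  have [|nd] := boolP (discharged l q); last first.
    have/(assertion_step_exact l wfq) := hq; apply: bsat_mono => q' q'a hq'.
    by split=> // -[].
  (* Here the disjunct for [h] is chosen. Its atoms are no heavier than [h], so none of them is the
     removed loop. *)
  case: q qS hq wfq => -[f s] t qS hq wff; rewrite /discharged /=.
  case fE: (until_parts f) => [[[l' g] h]|//] /andP[s1 hh].
  have [l01 wg wh _ lt_hf] := until_partsP fE wff.
  have dE : assertion_step (f, s, t) (pi l) = expand f s t (pi l) by [].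
  rewrite dE (expand_untilE _ _ _ fE) /expand_until s1 /=; left.
  have/(assertion_step_exact (q := (h, true, t)) l wh) := hh; apply: bsat_mono => q' q'a hq'.
  split=> //; first by rewrite mem_cat q'a.
  case=> q'E _; case/expand_atoms: q'a => [|[? [? [? [_ _]]]]]; rewrite q'E.
    by rewrite ltnNge /= ltnW.
  by case=> fh; rewrite fh ltnn in lt_hf.
- by move=> l q q' [].
move=> l [[f s] t] qS hq rq; have /andP[/= wff t0] := S_wf qS.
have [qa _ _] := rq 0%N; case/expand_atoms: qa => [|[l' [g [h [fE _ [tE]]]]]].
  by rewrite ltnn.
rewrite /= in fE.
have [l01 wg wh _ _] := until_partsP fE wff.
have g01 i : 0 <= sem R g (suffix (suffix pi l) i) <= 1 by exact: sem01.
have h01 i : 0 <= sem R h (suffix (suffix pi l) i) <= 1 by exact: sem01.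
case: s qS hq rq => qS hq rq.
  (* Some term of index [i] exceeds [t]; discounting never increases a value, so [h] exceeds [t] at
     [l + i] and the loop was cut there. *)
  have : ratr t < sem R f (suffix pi l) by exact: hq.
  rewrite (sem_untilE _ _ fE) => /(lt_uval (ratr01 R l01) g01 h01)[i [ti _]].
  have [_ _ []] := rq i; split=> //; rewrite /discharged /= fE /=.
  apply: (lt_le_trans ti); rewrite -suffix_add.
  by case/andP: (discount_le1 (ratr01 R l01) i (h01 i)).
(* An undiscounted until is accepting here. For a discounted one, [t / l2 = t] with [l2 < 1] forces
   [t = 0], and no value is below 0. *)
case: f fE wff qS hq {rq} => // l2 f2 f3 [l2E _ _] wff qS hq.
have /and4P[_ l21 _ _] := wff; rewrite -l2E in tE.
have t00 : t = 0.
  apply: contraTeq l21 => tn0; rewrite -leNgt.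
  suff -> : l2 = 1 by [].
  by apply/invr_inj/(mulfI tn0); rewrite invr1 mulr1.
have : sem R (FUntilD l2 f2 f3) (suffix pi l) < ratr t := hq.
rewrite t00 rmorph0 ltNge.
by have /andP[-> _] := sem01 R (suffix pi l) wff.
Qed.

(** Induction on the weight shows that every assertion reached by the run is true, or at least that
    no false one can be sustained. *)
Lemma accepted_lasso_above : accepts A pi -> lasso pi -> holds 0%N q0.
Proof.
case/(finite_automaton_accepted dS) => G [r [G0 GS Gr sat_r accG]].
case/lasso_periodic => m [p [p0 per]].
suff GH n f : (fweight f < n)%N -> forall l s t, G l (f, s, t) -> holds l (f, s, t).
  suff: forall q, G 0%N q -> holds 0%N q by apply.
  by case=> -[f s] t; exact: (GH _ _ (ltnSn _)).
elim: n f => [//|n IH] f; rewrite ltnS => le_n l0 s t0 Gl0.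
have wff : wf f by have /andP[] := S_wf (GS _ _ Gl0).
have {}IH l q : G l q -> (fweight q.1.1 < fweight f)%N -> holds l q.
  by case: q => -[f' s'] t' Gq /leq_trans/(_ le_n)/IH; apply.
apply/negPn/negP => n0.
(* A false assertion has a false successor in the run; lighter successors are true by induction, so
   it is the self-reference. *)
have step l t : G l (f, s, t) -> ~~ holds l (f, s, t) ->
    exists l' g h, [/\ until_parts f = Some (l', g, h), r l (f, s, t) (f, s, t / l') &
                       ~~ holds l.+1 (f, s, t / l')].
  move=> Gl nl.
  have := bsat_differ (sat_r _ _ Gl); move/(_ (fun q => holds l.+1 q)) => [].
    by move/(assertion_step_exact (q := (f, s, t)) l wff); apply/negP.
  move=> q [qa rq /negP nq].
  case/expand_atoms: qa => [/(IH _ _ (Gr _ _ _ Gl rq))|]; first by rewrite (negbTE nq).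
  by case=> l' [g [h [fE _ qE]]]; exists l', g, h; rewrite -qE.
have [l' [g [h [fE _ _]]]] := step _ _ Gl0 n0.
have {}step l t : G l (f, s, t) -> ~~ holds l (f, s, t) ->
    r l (f, s, t) (f, s, t / l') /\ ~~ holds l.+1 (f, s, t / l').
  by move=> Gl /(step _ _ Gl) [l2 [g2 [h2 []]]]; rewrite fE => -[<- _ _].
have [l01 wg wh lt_gf lt_hf] := until_partsP fE wff.
pose path k := (f, s, t0 / l' ^+ k).
have pathP k : G (l0 + k)%N (path k) /\ ~~ holds (l0 + k)%N (path k).
  elim: k => [|k [Gk nk]]; first by rewrite addn0 /path expr0 divr1.
  have [rk nk1] := step _ _ Gk nk.
  rewrite addnS /path exprSr invfM mulrA; split=> //; exact: Gr rk.
have [||k Fk] := accG l0 path.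
- by rewrite /path expr0 divr1.
- move=> k; have [Gk nk] := pathP k; have [+ _] := step _ _ Gk nk.
  by rewrite {2}/path exprSr invfM mulrA.
(* The false self-references form an infinite path, which must meet an accepting state; so [f] is an
   undiscounted until asserted below, and its threshold stays [t0]. *)
have [l1 s0] : l' = 1 /\ s = false.
  move: Fk; rewrite /path /until_below /=; case: (f) fE => // f1 f2 [<- _ _].
  by case: (s).
rewrite {}s0 {}l1 {path pathP step l01 Fk k} in fE Gl0 n0 *.
have g01 i : 0 <= sem R g (suffix (suffix pi l0) i) <= 1 by exact: sem01.
have h01 i : 0 <= sem R h (suffix (suffix pi l0) i) <= 1 by exact: sem01.
have t_le : ratr t0 <= sem R f (suffix pi l0) by rewrite leNgt; exact: n0.
have t1 : ratr t0 <= 1 :> R by apply: le_trans t_le _; case/andP: (sem01 R (suffix pi l0) wff).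
rewrite (sem_untilE _ _ fE) rmorph1 in t_le.
have hper i : (m <= i)%N -> sem R h (suffix (suffix pi l0) (i + p)) =
    sem R h (suffix (suffix pi l0) i).
  by move=> mi; rewrite !suffix_add addnA per // (leq_trans mi) // leq_addl.
have sat_below l f' : G l (f, false, t0) -> wf f' -> (fweight f' < fweight f)%N ->
    bsat (r l (f, false, t0)) (expand f' false t0 (pi l)) -> ~ ratr t0 <= sem R f' (suffix pi l).
  move=> Gl wf' lt_f' sat; apply/negP; rewrite -ltNge.
  apply/(assertion_step_exact (q := (f', false, t0)) l wf'); apply: bsat_mono sat => q qa rq.
  apply: IH (Gr _ _ _ Gl rq) _.
  by case: (expand_atoms qa) => [/ltn_trans|[? [? [? [_ _ ->]]]]]; [apply|].
(* Periodicity yields an index [i] where [h], and [g] before it, reach [t0]. The run refutes [h] at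
   each step and cannot refute [g] before [i], so it keeps looping until it contradicts [h] at
   [i]. *)
have [i []] := uval_attained p0 g01 h01 hper t1 t_le.
elim: i l0 Gl0 {n0 g01 h01 t_le hper} => [|i IHi] l Gl hi gi.
  have := sat_r _ _ Gl.
  rewrite [assertion_step _ _](expand_untilE _ _ _ fE) /expand_until /= => -[sat_h _].
  exact: sat_below hi.
have := sat_r _ _ Gl.
rewrite [assertion_step _ _](expand_untilE _ _ _ fE) /expand_until /= => -[_ [|sat_r']].
  move/(sat_below _ _ Gl wg lt_gf); apply; exact: (gi 0%N).
move: sat_r'; rewrite divr1 -(ler_rat R) rmorph1 t1 => rf.
apply: (IHi l.+1); first exact: Gr rf.
  by rewrite suffix_add addSnnS -suffix_add.
by move=> k ki; rewrite suffix_add addSnnS -suffix_add; exact: gi.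
Qed.

End Computation.
End Correctness.

(** * Growth of thresholds *)

(** Bernoulli's inequality for [p.+1 ^ q]. It says that a discount [p / q] drops to at most one half
    after [q] steps. *)
Lemma double_expn_le p q : (p < q)%N -> (2 * p ^ q <= q ^ q)%N.
Proof.
case: q => // q pq.
have bern n : (p ^ n.+1 + n.+1 * p ^ n <= p.+1 ^ n.+1)%N.
  elim: n => [|n IH]; first by rewrite !expn1 expn0; lia.
  by move: IH; rewrite [in X in (_ <= X)%N]expnS !expnS; nia.
apply: leq_trans (leq_trans (bern q) _); last by rewrite leq_exp2r.
by rewrite mul2n -addnn leq_add2l expnS leq_mul2r ltnW ?orbT.
Qed.

Lemma ltn_natbits n : (n < 2 ^ natbits n)%N.
Proof. exact: trunc_log_ltn. Qed.

(** The fraction may be unreduced, which spares all reasoning about common divisors. *)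
Definition denbits (N : nat) (x : rat) : Prop :=
  exists a b : nat, (0 < b <= 2 ^ N)%N /\ x = a%:R / b%:R.

Lemma denbits_le N N' x : (N <= N')%N -> denbits N x -> denbits N' x.
Proof.
move=> NN' [a [b [/andP[b0 bN] xE]]]; exists a, b; rewrite b0 (leq_trans bN) //.
by rewrite leq_exp2l.
Qed.

Lemma ratbits_num_den x : 0 <= x ->
  exists a b : nat, [/\ (0 < b <= 2 ^ ratbits x)%N & x = a%:R / b%:R].
Proof.
move=> x0; exists `|numq x|%N, `|denq x|%N; split.
  rewrite absz_gt0 denq_neq0 /= ltnW // (leq_trans (ltn_natbits _)) //.
  by rewrite leq_exp2l // leq_addl.
by rewrite !natr_absz !ger0_norm ?numq_ge0 // divq_num_den.
Qed.

Lemma denbits_ratbits x : 0 <= x -> denbits (ratbits x) x.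
Proof. by move=> /ratbits_num_den[a [b []]]; exists a, b. Qed.

Lemma denbits_opp N x : x <= 1 -> denbits N x -> denbits N (1 - x).
Proof.
move=> x1 [a [b [/andP[b0 bN] xE]]]; exists (b - a)%N, b; split; first by rewrite b0.
have b0' : 0 < b%:R :> rat by rewrite ltr0n.
rewrite natrB; last by move: x1; rewrite xE ler_pdivrMr // mul1r ler_nat.
by rewrite mulrBl divff ?lt0r_neq0 // xE.
Qed.

Section Rescaling.
Variables (L N : nat) (l x : rat).
Hypotheses (l01 : 0 < l < 1) (lL : (ratbits l <= L)%N).
Hypotheses (x0 : 0 < x) (xN : denbits N x).

Lemma discount_num_den : exists p q : nat,
  [/\ (0 < p)%N, (p < q <= 2 ^ L)%N & l = p%:R / q%:R].
Proof.
case/andP: l01 => l0 l1.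
have [p [q [/andP[q0 qL] lE]]] := ratbits_num_den (ltW l0).
have q0' : 0 < q%:R :> rat by rewrite ltr0n.
exists p, q; split=> //.
  by move: l0; rewrite lE pmulr_lgt0 ?invr_gt0 // ltr0n.
rewrite (leq_trans qL) ?leq_exp2l // andbT.
by move: l1; rewrite lE ltr_pdivrMr // mul1r ltr_nat.
Qed.

(** A positive [x] is at least [2^-1 ^+ N], while [l ^+ (q * N)] is at most that, where [q <= 2 ^ L]
    is the denominator of [l]. *)
Lemma rescale_steps j : x / l ^+ j <= 1 -> (j <= 2 ^ L * N)%N.
Proof.
have [p [q [p0 /andP[pq qL] lE]]] := discount_num_den.
case/andP: (l01) => l0 l1; rewrite ler_pdivrMr ?exprn_gt0 // mul1r => xl.
rewrite leqNgt; apply/negP => jb.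
have q0' : 0 < q%:R :> rat by rewrite ltr0n (ltn_trans p0).
have lq : l ^+ q <= 2^-1.
  rewrite lE expr_div_n ler_pdivrMr ?exprn_gt0 // mulrC ler_pdivlMr ?ltr0n //.
  by rewrite -!natrX -natrM ler_nat mulnC double_expn_le.
have lqN : l ^+ (q * N) <= 2^-1 ^+ N.
  by rewrite exprM lerXn2r // nnegrE ?exprn_ge0 ?ltW.
have x2 : 2^-1 ^+ N <= x.
  have [a [b [/andP[b0 bN] xE]]] := xN.
  have b0' : 0 < b%:R :> rat by rewrite ltr0n.
  rewrite exprVn xE ler_pdivlMr // mulrC ler_pdivrMr ?exprn_gt0 //.
  rewrite -natrX -natrM ler_nat (leq_trans bN) // leq_pmull //.
  by move: x0; rewrite xE pmulr_lgt0 ?invr_gt0 // ltr0n.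
have : l ^+ j < l ^+ (q * N).
  rewrite ltr_iXn2l // (leq_ltn_trans _ jb) // leq_mul2r qL orbT //.
by rewrite ltNge (le_trans lqN) // (le_trans x2).
Qed.

(** The denominator becomes [b * p ^ j] with [p <= 2 ^ L], so [L * j] bits are added and
    [rescale_steps] bounds [j]. *)
Lemma denbits_rescale j : x / l ^+ j <= 1 ->
  denbits (N * (1 + L * 2 ^ L)) (x / l ^+ j).
Proof.
move/rescale_steps => jb.
have [p [q [p0 /andP[pq qL] lE]]] := discount_num_den.
have [a [b [/andP[b0 bN] xE]]] := xN.
exists (a * q ^ j)%N, (b * p ^ j)%N; split.
  rewrite muln_gt0 b0 expn_gt0 p0 /= mulnDr muln1 expnD leq_mul //.
  apply: (@leq_trans ((2 ^ L) ^ j)).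
    by case: (j) => // k; rewrite leq_exp2r // (leq_trans (ltnW pq)).
  by rewrite -expnM leq_exp2l // mulnCA leq_mul2l mulnC jb orbT.
by rewrite xE lE expr_div_n invf_div mulrACA -invfM !natrM !natrX.
Qed.

End Rescaling.

Section Thresholds.
Variables (Lam : seq rat) (J : nat) (v : rat).

(* The values [> 1] are dropped: such thresholds are never tracked. *)
Definition rescaled (l : rat) (X : seq rat) : seq rat :=
  [seq x <- [seq y / l ^+ j | y <- X, j <- iota 0 J] | x <= 1].

(** One level adds what one layer of a formula can do to a threshold: complement it, or divide it
    repeatedly by one discount. *)
Fixpoint thresholds (k : nat) : seq rat :=
  if k is k'.+1 then
    let X := thresholds k' in
    X ++ [seq 1 - x | x <- X] ++ flatten [seq rescaled l X | l <- Lam]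
  else [:: v].

Lemma rescaledP l X x :
  reflect (exists y j, [/\ y \in X, (j < J)%N, y / l ^+ j <= 1 & x = y / l ^+ j])
          (x \in rescaled l X).
Proof.
rewrite mem_filter; apply: (iffP andP) => [[x1 /allpairsP[[y j] /= [yX jJ xE]]]|].
  by rewrite mem_iota add0n in jJ; exists y, j; rewrite -xE.
case=> y [j [yX jJ x1 ->]]; split=> //; apply/allpairsP; exists (y, j).
by rewrite mem_iota.
Qed.

Lemma thresholds_le k k' : (k <= k')%N -> {subset thresholds k <= thresholds k'}.
Proof.
move=> /subnK <-; elim: (k' - k)%N => [//|n IH] x /IH xk.
by rewrite addSn /= mem_cat xk.
Qed.

Lemma thresholds_opp k x : x \in thresholds k -> 1 - x \in thresholds k.+1.
Proof. by move=> xk; rewrite /= !mem_cat; apply/or3P/Or32/map_f. Qed.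

Lemma thresholds_rescaled l k : l \in Lam ->
  {subset rescaled l (thresholds k) <= thresholds k.+1}.
Proof.
move=> lL x xl; rewrite /= !mem_cat; apply/orP; right; apply/orP; right.
by apply/flatten_mapP; exists l.
Qed.

Lemma size_rescaled l X : (size (rescaled l X) <= size X * J)%N.
Proof. by rewrite size_filter (leq_trans (count_size _ _)) // size_allpairs size_iota. Qed.

Lemma size_thresholds k : (size (thresholds k) <= (2 + size Lam * J) ^ k)%N.
Proof.
elim: k => [//|k IH]; rewrite /= !size_cat size_map.
have : (size (flatten [seq rescaled l (thresholds k) | l <- Lam]) <=
        size Lam * (size (thresholds k) * J))%N.
  elim: Lam => //= l s IHs; rewrite size_cat mulSn leq_add //.
  exact: size_rescaled.
rewrite expnS; nia.
Qed.

Hypothesis Lam01 : forall l, l \in Lam -> 0 < l < 1.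
Hypothesis v01 : 0 <= v <= 1.

Lemma thresholds01 k x : x \in thresholds k -> 0 <= x <= 1.
Proof.
elim: k x => [|k IH] x; first by rewrite inE => /eqP ->.
rewrite /= !mem_cat => /or3P[/IH//|/mapP[y /IH/andP[y0 y1] ->]|].
  by rewrite subr_ge0 y1 gerBl.
case/flatten_mapP=> l /Lam01/andP[l0 _] /rescaledP[y [j [/IH/andP[y0 _] _ x1 ->]]].
by rewrite x1 divr_ge0 // exprn_ge0 // ltW.
Qed.

Variables (L N0 : nat).
Hypothesis Lam_bits : forall l, l \in Lam -> (ratbits l <= L)%N.
Hypothesis v_bits : (ratbits v <= N0)%N.
Let B := (1 + L * 2 ^ L)%N.

Lemma denbits_thresholds k x : x \in thresholds k -> denbits (N0 * B ^ k) x.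
Proof.
elim: k x => [|k IH] x.
  rewrite inE expn0 muln1 => /eqP ->; apply: denbits_le v_bits _.
  by apply: denbits_ratbits; case/andP: v01.
have leB : (N0 * B ^ k <= N0 * B ^ k.+1)%N by rewrite expnS leq_mul2l leq_pmull ?orbT.
rewrite /= !mem_cat => /or3P[/IH|/mapP[y yk ->]|]; first exact: denbits_le.
  apply: (denbits_le leB); apply: denbits_opp (IH _ yk).
  by case/andP: (thresholds01 yk).
case/flatten_mapP=> l lL /rescaledP[y [j [yk _ x1 ->]]].
have [y0|y_gt0|y0] := ltgtP y 0.
- by have /andP[] := thresholds01 yk; rewrite leNgt y0.
- rewrite expnSr mulnA; apply: denbits_rescale => //; [exact: Lam01|exact: Lam_bits|exact: IH].
by rewrite y0 mul0r; exists 0%N, 1%N; rewrite mul0r expn_gt0.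
Qed.

(** By [rescale_steps] a result that is still at most 1 needs fewer than [J] divisions, so the
    cutoff loses nothing. Zero is treated apart: it rescales to itself any number of times. *)
Lemma rescaled_closed l k x n : (k <= n)%N -> (2 ^ L * (N0 * B ^ n) < J)%N ->
  l \in Lam -> x \in rescaled l (thresholds k) -> x / l <= 1 ->
  x / l \in rescaled l (thresholds k).
Proof.
move=> kn JN lL /rescaledP[y [j [yk jJ x1 ->]]].
rewrite -mulrA -invfM -exprSr => x1'; apply/rescaledP.
have [y0|y_gt0|y0] := ltgtP y 0.
- by have /andP[] := thresholds01 yk; rewrite leNgt y0.
- exists y, j.+1; split=> //; apply: leq_ltn_trans JN.
  apply: (leq_trans (rescale_steps (Lam01 lL) (Lam_bits lL) y_gt0 (denbits_thresholds yk) x1')).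
  by rewrite leq_mul2l leq_mul2l leq_pexp2l ?orbT.
by exists y, j; rewrite y0 !mul0r in yk *.
Qed.

Lemma rescaled_sub l k : (0 < J)%N -> {subset thresholds k <= rescaled l (thresholds k)}.
Proof.
move=> J0 x xk; have /andP[_ x1] := thresholds01 xk.
by apply/rescaledP; exists x, 0%N; rewrite expr0 divr1.
Qed.

End Thresholds.

(** * The state set *)

Section Subformulas.
Variable AP : finType.
Implicit Types f g h : formula AP.

Fixpoint fheight f : nat :=
  match f with
  | FTrue | FAtom _ => 1
  | FNot g | FNext g => (fheight g).+1
  | FOr g h | FUntil g h | FUntilD _ g h => (maxn (fheight g) (fheight h)).+1
  end.

Lemma subformula_refl f : f \in subformulas f.
Proof. by case: f => *; exact: mem_head. Qed.

Lemma subformula_trans f g : g \in subformulas f ->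
  {subset subformulas g <= subformulas f}.
Proof.
elim: f => [|p|f1 IH1|f1 IH1 f2 IH2|f1 IH1|f1 IH1 f2 IH2|l f1 IH1 f2 IH2] /=;
  rewrite in_cons => /predU1P[-> //|gf] h hg; rewrite inE ?(IH1 gf) ?orbT //.
all: by move: gf; rewrite mem_cat => /orP[/IH1|/IH2] H; rewrite mem_cat H ?orbT.
Qed.

Lemma subformula_wf f g : g \in subformulas f -> wf f -> wf g.
Proof.
elim: f => [|p|f1 IH1|f1 IH1 f2 IH2|f1 IH1|f1 IH1 f2 IH2|l f1 IH1 f2 IH2] /=;
  rewrite in_cons => /predU1P[-> //|gf].
- by [].
- by [].
- exact: IH1.
- by move: gf; rewrite mem_cat => /orP[/IH1|/IH2] H /andP[wf1 wf2]; apply: H.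
- exact: IH1.
- by move: gf; rewrite mem_cat => /orP[/IH1|/IH2] H /andP[wf1 wf2]; apply: H.
- by move: gf; rewrite mem_cat => /orP[/IH1|/IH2] H /and4P[_ _ wf1 wf2]; apply: H.
Qed.

Lemma subformula_lambdas f g : g \in subformulas f ->
  {subset lambdas g <= lambdas f}.
Proof.
elim: f => [|p|f1 IH1|f1 IH1 f2 IH2|f1 IH1|f1 IH1 f2 IH2|l f1 IH1 f2 IH2] /=;
  rewrite in_cons => /predU1P[-> //|gf] h hg; rewrite ?(IH1 gf) //.
all: by rewrite ?inE mem_cat; move: gf; rewrite mem_cat => /orP[/IH1|/IH2] H; rewrite H ?orbT.
Qed.

Lemma subformula_height f g : g \in subformulas f -> (fheight g <= fheight f)%N.
Proof.
elim: f => [|p|f1 IH1|f1 IH1 f2 IH2|f1 IH1|f1 IH1 f2 IH2|l f1 IH1 f2 IH2] /=;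
  rewrite in_cons => /predU1P[-> //|].
- by [].
- by [].
- by move/IH1/leq_trans; apply.
- by rewrite mem_cat => /orP[/IH1|/IH2] H; rewrite ltnW // ltnS leq_max H ?orbT.
- by move/IH1/leq_trans; apply.
- by rewrite mem_cat => /orP[/IH1|/IH2] H; rewrite ltnW // ltnS leq_max H ?orbT.
- by rewrite mem_cat => /orP[/IH1|/IH2] H; rewrite ltnW // ltnS leq_max H ?orbT.
Qed.

(** A formula is strictly higher than its proper subformulas, so removing duplicates never removes
    it and each layer contributes a new element. *)
Lemma height_le_subformulas f : (fheight f <= size (undup (subformulas f)))%N.
Proof.
have strict g s : (forall h, h \in s -> (fheight h < fheight g)%N) ->
    (size (undup s) < size (undup (g :: s)))%N.
  by move=> H /=; case: ifP => // /H; rewrite ltnn.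
have sub s s' : {subset s <= s'} -> (size (undup s) <= size (undup s'))%N.
  move=> ss'; apply: uniq_leq_size (undup_uniq _) _ => x.
  by rewrite !mem_undup; exact: ss'.
have bin g g1 g2 : fheight g = (maxn (fheight g1) (fheight g2)).+1 ->
    (fheight g1 <= size (undup (subformulas g1)))%N ->
    (fheight g2 <= size (undup (subformulas g2)))%N ->
    (fheight g <= size (undup (g :: subformulas g1 ++ subformulas g2)))%N.
  move=> gE IH1 IH2; rewrite [X in (X <= _)%N]gE; apply: leq_trans (strict g _ _).
    rewrite ltnS geq_max (leq_trans IH1) ?(leq_trans IH2) //; apply: sub => x xs.
      by rewrite mem_cat xs orbT.
    by rewrite mem_cat xs.
  by move=> h; rewrite mem_cat gE ltnS leq_max => /orP[]/subformula_height ->; rewrite ?orbT.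
elim: f => [|p|f1 IH1|f1 IH1 f2 IH2|f1 IH1|f1 IH1 f2 IH2|l f1 IH1 f2 IH2] //.
- apply: leq_ltn_trans IH1 (strict _ _ _) => h /subformula_height; by rewrite /= ltnS.
- exact: bin.
- apply: leq_ltn_trans IH1 (strict _ _ _) => h /subformula_height; by rewrite /= ltnS.
- exact: bin.
- exact: bin.
Qed.

Lemma wf_lambdas f l : wf f -> l \in lambdas f -> 0 < l < 1.
Proof.
elim: f => [|p|f1 IH1|f1 IH1 f2 IH2|f1 IH1|f1 IH1 f2 IH2|l' f1 IH1 f2 IH2] //=.
- by case/andP=> w1 w2; rewrite mem_cat => /orP[/(IH1 w1)|/(IH2 w2)].
- by case/andP=> w1 w2; rewrite mem_cat => /orP[/(IH1 w1)|/(IH2 w2)].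
case/and4P=> l0 l1 w1 w2; rewrite inE mem_cat => /or3P[/eqP ->|/(IH1 w1)|/(IH2 w2)] //.
by rewrite l0.
Qed.

End Subformulas.

Section StateSet.
Variables (AP : finType) (phi : formula AP) (v : rat).
Implicit Types f g h : formula AP.
Hypotheses (wf_phi : wf phi) (v01 : 0 <= v <= 1).
Variables (L J : nat).
Let Lam := undup (lambdas phi).
Let n := fheight phi.
Hypothesis Lam_bits : forall l, l \in Lam -> (ratbits l <= L)%N.
Hypothesis JN : (2 ^ L * (ratbits v * (1 + L * 2 ^ L) ^ n) < J)%N.

Lemma Lam01 l : l \in Lam -> 0 < l < 1.
Proof. by rewrite mem_undup; exact: wf_lambdas. Qed.

Local Notation th := (thresholds Lam J v).

(* Nesting depth [fheight phi - fheight f] bounds how often a threshold has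
   been negated or rescaled before it reaches [f]. *)
Definition state_thresholds (f : formula AP) : seq rat :=
  let X := th (n - fheight f) in
  if f is FUntilD l _ _ then rescaled J l X else X.

Definition state_list : seq (assertion AP) :=
  undup [seq (fs, x) | fs <- [seq (f, s) | f <- undup (subformulas phi), s <- [:: true; false]],
                       x <- state_thresholds fs.1].

Lemma mem_state_list f s t :
  ((f, s, t) \in state_list) = (f \in subformulas phi) && (t \in state_thresholds f).
Proof.
rewrite mem_undup; apply/allpairsPdep/andP => [[[f' s'] [x [+ xt [fE sE tE]]]]|[fs ft]].
  case/allpairsP=> -[f2 s2] /= [+ _ [f2E _]]; rewrite mem_undup -f2E => f'phi.
  by rewrite fE tE.
exists (f, s), t; split=> //; apply/allpairsP; exists (f, s).
by rewrite mem_undup; case: (s).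
Qed.

Let J0 : (0 < J)%N.
Proof. exact: leq_ltn_trans JN. Qed.

Lemma state_thresholds_sub f : {subset th (n - fheight f) <= state_thresholds f}.
Proof.
case: f => [|p|g|g h|g|g h|l g h] t tf; try exact: tf.
exact: (rescaled_sub Lam01 v01).
Qed.

(** A child has smaller height and hence at least one more level of thresholds; a discounted until
    contains that level as its zero-fold rescalings. *)
Lemma state_thresholds_child f g t : (fheight g < fheight f)%N -> (fheight f <= n)%N ->
  t \in th (n - fheight f).+1 -> t \in state_thresholds g.
Proof.
move=> gf fn tf; have {}tf : t \in th (n - fheight g).
  by apply: thresholds_le tf; rewrite ltn_sub2l // (leq_trans gf).
by case: g gf tf => //= l g h _ tf; apply: (rescaled_sub Lam01 v01).
Qed.

Lemma state_thresholds_next f t : f \in subformulas phi ->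
  t \in state_thresholds f -> t \in th (n - fheight f).+1.
Proof.
case: f; rewrite /state_thresholds => *; try by apply: thresholds_le (leqnSn _) _ _.
apply: thresholds_rescaled; last by eassumption.
rewrite mem_undup; apply: (subformula_lambdas (g := FUntilD _ _ _)).
  by eassumption.
exact: mem_head.
Qed.

(** Negation and disjunction unfold within one step, hence the induction on the formula. Children
    draw on the next level, whereas a self-reference stays in its own. *)
Lemma state_list_closed q a q' : q \in state_list ->
  q' \in pbf_atoms (assertion_step q a) -> q' \in state_list.
Proof.
case: q => -[f s] t; rewrite mem_state_list /assertion_step /=.
have child g g' t' : g \in subformulas phi -> g' \in subformulas g ->
    (fheight g' < fheight g)%N -> t' \in th (n - fheight g).+1 ->
    (g' \in subformulas phi) && (t' \in state_thresholds g').
  move=> gphi g'g hg t'g; rewrite (subformula_trans gphi) //=.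
  by apply: state_thresholds_child t'g => //; exact: subformula_height.
have until g1 g2 l g s' t' : until_parts g = Some (l, g1, g2) ->
    (forall t', (g1 \in subformulas phi) && (t' \in state_thresholds g1) ->
      q' \in pbf_atoms (expand g1 s' t' a) -> q' \in state_list) ->
    (forall t', (g2 \in subformulas phi) && (t' \in state_thresholds g2) ->
      q' \in pbf_atoms (expand g2 s' t' a) -> q' \in state_list) ->
    g \in subformulas phi -> t' \in state_thresholds g ->
    q' \in pbf_atoms (expand_until g s' t' l (expand g1 s' t' a) (expand g2 s' t' a)) ->
    q' \in state_list.
  move=> gE IH1 IH2 gphi t'g; have t'n := state_thresholds_next gphi t'g.
  have [g1g g2g h1 h2] : [/\ g1 \in subformulas g, g2 \in subformulas g,
      (fheight g1 < fheight g)%N & (fheight g2 < fheight g)%N].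
    case: (g) gE => //= [? ? [_ -> ->]|? ? ? [_ -> ->]]; rewrite !ltnS leq_maxl leq_maxr;
      by rewrite !inE !mem_cat !subformula_refl !orbT.
  rewrite /expand_until !pbf_atoms_sel !mem_cat => /or3P[/IH2|/IH1|].
  - by apply; apply: child t'n.
  - by apply; apply: child t'n.
  case: ifP => [tl|_]; last by rewrite pbf_atoms_bool.
  rewrite inE => /eqP ->; rewrite mem_state_list gphi /=.
  case: (g) gE gphi t'g => //= [? ? [<- _ _] _|l' ? ? [l'E _ _] gphi]; first by rewrite divr1.
  rewrite l'E /state_thresholds => t'g.
  apply: (rescaled_closed Lam01 v01 Lam_bits (leqnn _) (leq_subr _ _) JN) => //.
  by rewrite mem_undup; apply: (subformula_lambdas gphi); rewrite -l'E mem_head.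
elim: f s t => [|p|g IHg|g IHg h IHh|g IHg|g IHg h IHh|l g IHg h IHh] s t /andP[fphi tf].
- by rewrite /= pbf_atoms_bool.
- by rewrite /= pbf_atoms_bool.
- apply: IHg; apply: (child _ _ _ fphi) => //; first by rewrite inE subformula_refl orbT.
  apply: thresholds_opp; exact: tf.
- have t'n := state_thresholds_next fphi tf.
  rewrite /= pbf_atoms_sel mem_cat => /orP[/IHg|/IHh]; apply; apply: (child _ _ _ fphi) => //.
  + by rewrite inE mem_cat subformula_refl !orbT.
  + by rewrite /= ltnS leq_maxl.
  + by rewrite inE mem_cat subformula_refl !orbT.
  + by rewrite /= ltnS leq_maxr.
- have t'n := state_thresholds_next fphi tf.
  rewrite inE => /eqP ->; rewrite mem_state_list; apply: (child _ _ _ fphi) => //.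
  by rewrite inE subformula_refl orbT.
- by apply: (until g h 1 (FUntil g h)) => // t'; [exact: IHg|exact: IHh].
- by apply: (until g h l (FUntilD l g h)) => // t'; [exact: IHg|exact: IHh].
Qed.

Lemma state_list_wf q : q \in state_list -> wf q.1.1 && (0 <= q.2).
Proof.
case: q => -[f s] t; rewrite mem_state_list => /andP[fphi tf] /=.
rewrite (subformula_wf fphi) //=.
by case/andP: (thresholds01 Lam01 v01 (state_thresholds_next fphi tf)).
Qed.

Lemma init_state_list : (phi, true, v) \in state_list.
Proof.
rewrite mem_state_list subformula_refl; apply: state_thresholds_sub.
by rewrite subnn mem_head.
Qed.

(** The factor 2 counts polarities, and the last [J] the extra rescalings of a discounted until. *)
Lemma size_state_list : (size state_list <=
  2 * size (undup (subformulas phi)) * ((2 + size Lam * J) ^ n * J))%N.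
Proof.
apply: leq_trans (size_undup _) _; rewrite size_allpairs_dep sumnE big_map.
apply: (@leq_trans (\sum_(fs <- [seq (f, s) | f <- undup (subformulas phi), s <- [:: true; false]])
    ((2 + size Lam * J) ^ n * J))).
  apply: leq_sum => -[f s] _ /=.
  have le_th : (size (th (n - fheight f)) <= (2 + size Lam * J) ^ n)%N.
    apply: leq_trans (size_thresholds _ _ _ _) _; by rewrite leq_pexp2l // leq_subr.
  have le_th' : (size (th (n - fheight f)) <= (2 + size Lam * J) ^ n * J)%N.
    by rewrite (leq_trans le_th) // leq_pmulr.
  case: f le_th le_th' => // l g h le_th _.
  by rewrite (leq_trans (size_rescaled _ _ _)) // leq_mul2r le_th orbT.
by rewrite big_const_seq count_predT iter_addn_0 size_allpairs /= mulnC [(_ * 2)%N]mulnC.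
Qed.

End StateSet.

(** * Counting the states and assembling the automaton *)

Lemma state_count_bound (K M s n N J : nat) : (3 <= K)%N -> (M <= K)%N -> (s <= K)%N ->
  (n <= K)%N -> (N <= K)%N -> J = (2 ^ K * (N * (1 + K * 2 ^ K) ^ n)).+1 ->
  (2 * s * ((2 + M * J) ^ n * J) <= 2 ^ (K ^ 5))%N.
Proof.
move=> K3 MK sK nK NK JE.
have K2 : (K < 2 ^ K)%N by exact: ltn_expl.
have p2 a b : (a <= b)%N -> (2 ^ a <= 2 ^ b)%N by move=> ab; rewrite leq_exp2l.
have leB : ((1 + K * 2 ^ K) ^ n <= 2 ^ (2 * K * K))%N.
  apply: (@leq_trans ((2 ^ (2 * K)) ^ n)); last by rewrite -expnM p2 // leq_mul2l nK orbT.
  have : (1 + K * 2 ^ K <= 2 ^ (2 * K))%N by rewrite mul2n -addnn expnD; nia.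
  by case: (n) => // k; rewrite leq_exp2r.
have JK : (J <= 2 ^ (3 * K * K))%N.
  have : (2 ^ K * (N * (1 + K * 2 ^ K) ^ n) <= 2 ^ K * (2 ^ K * 2 ^ (2 * K * K)))%N.
    by rewrite leq_mul2l leq_mul ?orbT // (leq_trans NK) // ltnW.
  rewrite -!expnD => /leq_ltn_trans H; rewrite JE; apply: H.
  by rewrite ltn_exp2l //; nia.
have J1 : (0 < J)%N by rewrite JE.
have base : (2 + M * J <= 2 ^ (4 * K * K))%N.
  apply: (@leq_trans (2 ^ K * 2 ^ (3 * K * K))); last by rewrite -expnD p2 //; nia.
  apply: (@leq_trans (2 ^ K * J)); last by rewrite leq_mul2l JK orbT.
  have : (K.+2 <= 2 ^ K)%N.
    case: (K) K3 => // k k2; rewrite expnS; have : (k < 2 ^ k)%N by exact: ltn_expl.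
    by lia.
  by nia.
have pow : ((2 + M * J) ^ n <= 2 ^ (4 * K * K * K))%N.
  apply: (@leq_trans ((2 ^ (4 * K * K)) ^ n)).
    by case: (n) => // k; rewrite leq_exp2r.
  by rewrite -expnM p2 // leq_mul2l nK orbT.
have twos : (2 * s <= 2 ^ K.+1)%N.
  by rewrite expnS leq_mul2l (leq_trans sK) // ltnW.
apply: leq_trans (leq_mul twos (leq_mul pow JK)) _.
(* The exponents sum to [K + 1 + 4 * K ^ 3 + 3 * K ^ 2], which is at most [K ^ 5] from [K = 3]
   on. *)
rewrite -!expnD p2 //.
have -> : (K ^ 5 = K * K * (K * K) * K)%N by rewrite !expnS expn0; lia.
have K9 : (9 <= K * K)%N by nia.
have K27 : (9 * K <= K * K * K)%N by nia.
have : (9 * (K * K * K) <= K * K * (K * K) * K)%N by nia.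
nia.
Qed.

Lemma ratbits_gt0 q : (0 < ratbits q)%N.
Proof. by rewrite /ratbits addSn. Qed.

Lemma ratbits_lambda (AP : finType) (f : formula AP) l :
  l \in undup (lambdas f) -> (ratbits l <= fsize f)%N.
Proof.
move=> lf; rewrite /fsize (big_rem l) //=.
by rewrite addnCA leq_addr.
Qed.

Lemma size_lambdas (AP : finType) (f : formula AP) :
  (size (undup (lambdas f)) <= fsize f)%N.
Proof.
rewrite /fsize; apply: leq_trans (leq_addl _ _).
rewrite -sum1_size; apply: leq_sum => l _; exact: ratbits_gt0.
Qed.

Theorem theorem2 :
  exists c : nat,
  forall (AP : finType) (phi : formula AP) (v : rat),
    wf phi -> 0 <= v <= 1 ->
    exists A : ABA {set AP},
      weak A /\
      (#|states A| <= 2 ^ ((fsize phi + ratbits v) ^ c))%N /\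
      forall (R : realType) (pi : computation AP),
        (ratr v < sem R phi pi -> accepts A pi) /\
        (accepts A pi -> lasso pi -> ratr v < sem R phi pi).
Proof.
exists 5%N => AP phi v wf_phi v01.
set K := (fsize phi + ratbits v)%N.
have leK m : (m <= fsize phi)%N -> (m <= K)%N by move/leq_trans; apply; exact: leq_addr.
have subK : (size (undup (subformulas phi)) <= K)%N by apply: leK; exact: leq_addr.
(* [ratbits v] is at least 2 and there is at least one subformula. *)
have K3 : (3 <= K)%N.
  rewrite /K /ratbits /natbits !addSn !addnS !ltnS addnC; apply: leq_trans (leq_addl _ _).
  apply: leq_trans (leq_addr _ _); rewrite lt0n size_eq0; apply/eqP => s0.
  by have := subformula_refl phi; rewrite -mem_undup s0.
(* One more than the number of divisions possible at the deepest level, where thresholds have the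
   largest denominators. *)
pose J := (2 ^ K * (ratbits v * (1 + K * 2 ^ K) ^ fheight phi)).+1.
have Lam_bits l : l \in undup (lambdas phi) -> (ratbits l <= K)%N.
  by move/ratbits_lambda/leK.
have JN : (2 ^ K * (ratbits v * (1 + K * 2 ^ K) ^ fheight phi) < J)%N by exact: ltnSn.
have S_closed := state_list_closed wf_phi v01 Lam_bits JN.
have S_wf := state_list_wf wf_phi v01 (J := J).
have S_init := init_state_list wf_phi v01 JN.
have S_uniq : uniq (state_list phi v J) by exact: undup_uniq.
exists (finite_automaton (@assertion_step AP) (@until_below AP) S_init); split.
  apply: (finite_automaton_weak _ S_uniq _ S_closed (@assertion_lt_irr AP)
            (@assertion_lt_trans AP)) => q a q'; exact: assertion_step_lt.
split.
  rewrite card_finite_automaton (leq_trans (size_state_list JN)) //.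
  apply: (state_count_bound (N := ratbits v)) => //.
  - exact/leK/size_lambdas.
  - exact: leq_trans (height_le_subformulas _) subK.
  - exact: leq_addl.
move=> R pi; split; first exact: (@above_accepted _ _ _ S_uniq S_init S_closed S_wf R pi).
exact: (@accepted_lasso_above _ _ _ S_init S_closed S_wf R pi).
Qed.
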